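(* Let $G$ be a connected graph (without loops) and let $H:V(G)\to 2^{\mathbb{N}}$ be such that $(G,H)$ is dense. Then $G$ has an $H$-orientation if and only if there is no parity trace $(x_1,\dots,x_k)$ of $(G,H)$ for which $|V^1|\not\equiv e(G)\pmod 2$.
   Context: An orientation $O$ of $G$ assigns a direction to each edge; $d^+_O(v)$ is the out-degree of $v$. For $H:V(G)\to 2^{\mathbb{N}}$, an $H$-orientation is an orientation $O$ with $d^+_O(v)\in H(v)$ for all $v$. The pair $(G,H)$ is called dense if $G$ is connected and for every $v\in V(G)$ and every integer $i$ with $0\le i\le d_G(v)-1$: if $i\notin H(v)$ then $i+1\in H(v)$. For $S\subseteq V(G)$, $e(S)$ is the number of edges of $G[S]$, $e(G)=|E(G)|$, and $d_G(x,S)$ is the number of edges joining $x$ to vertices of $S$. Say $H(x)$ is odd (resp. even) if $H(x)\cap[0,d_G(x)]$ is nonempty and consists only of odd (resp. even) integers. Let $V^1_0=\{x: H(x)\text{ is odd}\}$, $V^2_0=\{x: H(x)\text{ is even}\}$. An ordering $(x_1,\dots,x_k)$ of $V(G)\setminus(V^1_0\cup V^2_0)$ is a parity trace if, defining recursively for $i=1,\dots,k$: $l_i$ = the number of components $C$ of $G-x_i$ with $V(C)\subseteq V^1_{i-1}\cup V^2_{i-1}$ and $|V(C)\cap V^1_{i-1}|+e(C)\not\equiv d_G(x_i,V(C))\pmod 2$; $t_i$ = the number of components $C$ of $G-x_i$ with $V(C)\subseteq V^1_{i-1}\cup V^2_{i-1}$ and $|V(C)\cap V^1_{i-1}|\not\equiv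 e(C)\pmod 2$; $u_i=d_G(x_i)-t_i$, it holds that all elements of $[l_i,u_i]\cap H(x_i)$ have the same parity (where $[s,t]=\{s,s+1,\dots,t\}$); and then $V^1_i=V^1_{i-1}\cup\{x_i\}$, $V^2_i=V^2_{i-1}$ if these elements are odd, $V^1_i=V^1_{i-1}$, $V^2_i=V^2_{i-1}\cup\{x_i\}$ if they are even (if $[l_i,u_i]\cap H(x_i)=\emptyset$, either choice is allowed). For a parity trace, $V^1:=V^1_k$. *)

(* Defs.v *)
From mathcomp Require Import all_boot.
From mathcomp Require Import boolp.

Set Implicit Arguments.
Unset Strict Implicit.
Unset Printing Implicit Defensive.

(* Finite loopless graphs. Distinct edges may have the same ends (parallel
   edges); loops are excluded because every edge has two distinct ends. *)
Record graph := Graph {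
  vertex : finType;
  edge : finType;
  ends : edge -> {set vertex};
  card_ends : forall e : edge, #|ends e| = 2
}.

Section GraphTheory.
Variable G : graph.
Implicit Types (x y v : vertex G) (S : {set vertex G}).

Definition adj : rel (vertex G) :=
  fun x y => [exists e : edge G, ends e == [set x; y]].

Definition connected : Prop :=
  0 < #|vertex G| /\ forall x y, connect adj x y.

Definition adj_in S : rel (vertex G) :=
  fun x y => [&& x \in S, y \in S & adj x y].

(* Vertex sets of the connected components of the induced subgraph G[S]. *)
Definition components S : {set {set vertex G}} :=
  equivalence_partition (connect (adj_in S)) S.

Definition deg v : nat := #|[set e : edge G | v \in ends e]|.

Definition deg_to x S : nat :=
  #|[set e : edge G | [exists y in S, ends e == [set x; y]]]|.

Definition num_edges_in S : nat := #|[set e : edge G | ends e \subset S]|.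

Definition num_edges : nat := #|edge G|.

(* [O e] is the pair (tail, head) of the edge [e]. *)
Definition orientation (O : edge G -> vertex G * vertex G) : Prop :=
  forall e, ends e = [set (O e).1; (O e).2].

Definition outdeg (O : edge G -> vertex G * vertex G) v : nat :=
  #|[set e : edge G | (O e).1 == v]|.

(* [H v i] reads "i belongs to H(v)". *)
Variable H : vertex G -> nat -> Prop.

Definition H_orientation (O : edge G -> vertex G * vertex G) : Prop :=
  orientation O /\ forall v, H v (outdeg O v).

Definition dense : Prop :=
  connected /\ forall v i, i < deg v -> ~ H v i -> H v i.+1.

Definition H_odd x : Prop :=
  (exists2 i, i <= deg x & H x i) /\
  (forall i, i <= deg x -> H x i -> odd i).

Definition H_even x : Prop :=
  (exists2 i, i <= deg x & H x i) /\
  (forall i, i <= deg x -> H x i -> ~~ odd i).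

Definition V1_init : {set vertex G} := [set x | `[< H_odd x >]].
Definition V2_init : {set vertex G} := [set x | `[< H_even x >]].

Definition trace_l (V1 V2 : {set vertex G}) x : nat :=
  #|[set C in components (~: [set x]) | (C \subset V1 :|: V2) &&
      (#|C :&: V1| + num_edges_in C != deg_to x C %[mod 2])]|.

Definition trace_t (V1 V2 : {set vertex G}) x : nat :=
  #|[set C in components (~: [set x]) | (C \subset V1 :|: V2) &&
      (#|C :&: V1| != num_edges_in C %[mod 2])]|.

(* i \in [l, u] for u = deg x - t, written without truncated subtraction. *)
Definition in_window (V1 V2 : {set vertex G}) x (i : nat) : Prop :=
  trace_l V1 V2 x <= i /\ i + trace_t V1 V2 x <= deg x.

(* [trace_steps V1 V2 xs W1 W2]: processing the vertices of xs in order turns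
   the pair (V1, V2) into (W1, W2). Both step constructors apply when the
   window does not meet H(x), so that either choice is then allowed. *)
Inductive trace_steps (V1 V2 : {set vertex G}) :
    seq (vertex G) -> {set vertex G} -> {set vertex G} -> Prop :=
| trace_nil : trace_steps V1 V2 [::] V1 V2
| trace_odd x xs W1 W2 :
    (forall i, in_window V1 V2 x i -> H x i -> odd i) ->
    trace_steps (x |: V1) V2 xs W1 W2 ->
    trace_steps V1 V2 (x :: xs) W1 W2
| trace_even x xs W1 W2 :
    (forall i, in_window V1 V2 x i -> H x i -> ~~ odd i) ->
    trace_steps V1 (x |: V2) xs W1 W2 ->
    trace_steps V1 V2 (x :: xs) W1 W2.

(* The ordering xs is a parity trace, with final sets V^1 = W1, V^2 = W2. *)
Definition parity_trace (xs : seq (vertex G)) (W1 W2 : {set vertex G}) : Prop :=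
  [/\ uniq xs, xs =i ~: (V1_init :|: V2_init)
    & trace_steps V1_init V2_init xs W1 W2].

End GraphTheory.

(* Main.v *)
Require Import Defs.
From mathcomp Require Import all_boot.
From mathcomp Require Import boolp zify.

Set Implicit Arguments.
Unset Strict Implicit.
Unset Printing Implicit Defensive.

(* Call a vertex good when its out-degree lies in H. By density, flipping an edge
   at a bad vertex makes it good, so badness can be moved along paths, and inside
   any connected vertex set S all vertices but a prescribed one can be made good
   without touching the edges outside G[S].

   If an H-orientation exists, then by induction along a parity trace every
   processed vertex has the out-degree parity assigned to it, since parity
   counts in the components of G - x force the out-degree of x into the window
   [l, u].  Summing all out-degrees gives the parity of the final V^1.

   Conversely, for x unprocessed, a processed component C of G - x can be made
   good for every orientation of the edges between x and C that has the right
   parity, so processed components together realise exactly the out-degrees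
   b = l (mod 2) in a window.  For an arbitrary component C, flipping at most one
   prescribed edge between x and C makes C good.  Hence if x is chosen so that at
   most one component of G - x is not fully processed, and two elements of
   H(x) in the window have different parities, then the window contains two
   consecutive elements of H(x), one of which is realised by an H-orientation.
   Otherwise x can be processed, and at the last vertex the parity can be chosen
   to be wrong. *)

(** * Counting and parity of finite sums *)

Lemma card_set_sum (T : finType) (P : pred T) : #|[set x | P x]| = \sum_x P x.
Proof.
rewrite -sum1_card big_mkcond; apply: eq_bigr => x _.
by rewrite inE; case: (P x).
Qed.

Lemma sum_eq_mem (T : finType) (A : {set T}) v :
  \sum_(u in A) (u == v) = (v \in A) :> nat.
Proof.
case vA: (v \in A).
  by rewrite (bigD1 v) //= eqxx big1 ?addn0 // => u /andP[_ /negbTE->].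
by rewrite big1 // => u uA; case: eqP uA => // ->; rewrite vA.
Qed.

Lemma odd_sum (I : Type) (r : seq I) (P : pred I) (F : I -> nat) :
  odd (\sum_(i <- r | P i) F i) = \big[addb/false]_(i <- r | P i) odd (F i).
Proof. by apply: (big_morph odd oddD). Qed.

Lemma odd_sum_mem (T : finType) (A B : {set T}) (F : T -> nat) :
  {in A, forall v, odd (F v) = (v \in B)} ->
  odd (\sum_(v in A) F v) = odd #|A :&: B|.
Proof.
move=> oF; rewrite -sum1_card big_mkcond /= [in RHS]big_mkcond /= !odd_sum.
apply: eq_bigr => v _; rewrite inE.
by case: ifP => //= vA; rewrite oF //; case: (v \in B).
Qed.

Lemma neq_mod2 m n : (m != n %[mod 2]) = odd (m + n).
Proof. by rewrite !modn2 oddD; case: (odd m); case: (odd n). Qed.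

(** Greedy split: the second summand [b - k] takes its least value [L] unless this makes [k] exceed
    [d - t]; then [k = d - t], which has the parity of [l]. *)
Lemma split_count l t d L T D b : l + t <= d -> odd (l + t) = odd d ->
  L + T <= D -> l + L <= b -> b + (t + T) <= d + D -> odd b = odd (l + L) ->
  exists k, [/\ l <= k <= b, k + t <= d, odd k = odd l &
    [/\ L <= b - k, b - k + T <= D & odd (b - k) = odd L]].
Proof.
move=> *; have [le|lt] := leqP (b - L) (d - t).
  by exists (b - L); do 2?split; lia.
by exists (d - t); do 2?split; lia.
Qed.

Section Orientations.
Variable G : graph.
Local Notation V := (vertex G).
Local Notation E := (edge G).
Implicit Types (O : E -> V * V) (x y z v : V) (e f : E) (S C K L : {set V}).

(** * Components of induced subgraphs *)

Lemma adjC : symmetric (@adj G).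
Proof. by move=> x y; apply: eq_existsb => e; rewrite setUC. Qed.

Lemma adj_inC S : symmetric (adj_in S).
Proof. by move=> x y; rewrite /adj_in adjC andbCA. Qed.

Lemma connect_adj_inC S : connect_sym (adj_in S).
Proof. exact/sym_connect_sym/adj_inC. Qed.

Lemma connect_adj_in_equiv S :
  {in S & &, equivalence_rel (connect (adj_in S))}.
Proof.
move=> x y z _ _ _; split=> // cxy.
by apply: same_connect => //; exact: connect_adj_inC.
Qed.

Lemma components_partition S : partition (components S) S.
Proof. exact: (equivalence_partitionP (@connect_adj_in_equiv S)). Qed.

Lemma sub_component S C : C \in components S -> C \subset S.
Proof.
move=> CS; rewrite -(cover_partition (components_partition S)).
exact: bigcup_sup.
Qed.

Lemma component_mem S C x : C \in components S -> x \in C -> x \in S.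
Proof. by move=> /sub_component/subsetP; apply. Qed.

Lemma mem_component S C x y : C \in components S -> x \in C ->
  (y \in C) = (y \in S) && connect (adj_in S) x y.
Proof.
move=> CS xC; have xS := component_mem CS xC.
have pt := components_partition S.
have -> : C = pblock (components S) x.
  by rewrite (def_pblock _ CS xC) //; case/and3P: pt.
case yS: (y \in S); last first.
  apply/negbTE/negP => yC.
  have := pblock_mem (T := V); move/(_ (components S) x).
  rewrite (cover_partition pt) => /(_ xS) /component_mem /(_ yC).
  by rewrite yS.
exact: (pblock_equivalence_partition (@connect_adj_in_equiv S)).
Qed.

Lemma component_neq0 S C : C \in components S -> exists x, x \in C.
Proof.
case/and3P: (components_partition S) => _ _ n0 CS.
by apply/set0Pn; apply: contraNneq n0 => <-.
Qed.

Lemma component_eq S C K x :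
  C \in components S -> K \in components S -> x \in C -> x \in K -> C = K.
Proof.
move=> CS KS xC xK; apply/setP => y.
by rewrite (mem_component _ CS xC) (mem_component _ KS xK).
Qed.

Lemma componentP S x : x \in S -> exists2 C, C \in components S & x \in C.
Proof.
rewrite -{1}(cover_partition (components_partition S)).
by case/bigcupP => C; exists C.
Qed.

Lemma component_adj S C x y :
  C \in components S -> x \in C -> y \in S -> adj x y -> y \in C.
Proof.
move=> CS xC yS axy; rewrite (mem_component _ CS xC) yS; apply: connect1.
by rewrite /adj_in (component_mem CS xC) yS.
Qed.

Lemma connect_sub_in S C x y : {in C & S, forall u v, adj u v -> v \in C} ->
  x \in C -> connect (adj_in S) x y -> connect (adj_in C) x y && (y \in C).
Proof.
move=> clC xC /connectP[p]; elim: p x xC => [|z p IH] x xC /=.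
  by move=> _ ->; rewrite connect0 xC.
case/andP=> /and3P[_ zS axz] pp ly; have zC := clC _ _ xC zS axz.
case/andP: (IH _ zC pp ly) => c ->; rewrite andbT; apply: connect_trans c.
by apply: connect1; rewrite /adj_in xC zC.
Qed.

Lemma component_connect S C : C \in components S ->
  {in C &, forall x y, connect (adj_in C) x y}.
Proof.
move=> CS x y xC yC.
have: connect (adj_in S) x y.
  by move: yC; rewrite (mem_component _ CS xC) => /andP[].
case/(connect_sub_in (C := C))/andP => // u v uC vS.
exact: component_adj CS uC vS.
Qed.

Lemma connect_in_sub S C x y :
  C \subset S -> connect (adj_in C) x y -> connect (adj_in S) x y.
Proof.
move=> /subsetP sCS; apply: connect_sub => u v /and3P[uC vC a].
by apply: connect1; rewrite /adj_in !sCS.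
Qed.

Lemma ends_adj e x y : ends e = [set x; y] -> adj x y.
Proof. by move=> eE; apply/existsP; exists e; rewrite eE. Qed.

Lemma ends_neq e x y : ends e = [set x; y] -> x != y.
Proof. by move=> eE; have := card_ends e; rewrite eE cards2; case: eqVneq. Qed.

Lemma component_neighbor x C : connected G -> C \in components (~: [set x]) ->
  exists2 z, z \in C & adj x z.
Proof.
move=> [_ cG] CS; have [z zC] := component_neq0 CS.
apply/exists_inP; apply: contraT => /exists_inPn nadj.
have clC : closed (@adj G) C.
  apply: intro_closed => [|u v auv uC]; first exact/sym_connect_sym/adjC.
  apply: (component_adj CS uC _ auv); rewrite !inE.
  by apply/eqP => vx; have := nadj _ uC; rewrite -vx adjC auv.
have := closed_connect clC (cG z x); rewrite zC => /esym/(component_mem CS).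
by rewrite !inE eqxx.
Qed.

(** By connectedness every other component of [G - x] is joined to [x], so deleting [C] separates no
    remaining vertex from [x]. *)
Lemma setC_component_connect x C : connected G ->
  C \in components (~: [set x]) ->
  {in ~: C, forall v, connect (adj_in (~: C)) v x}.
Proof.
move=> cG CS v vC; have [->//|vx] := eqVneq v x.
have xC : x \in ~: C.
  by rewrite inE; apply/negP => /(component_mem CS); rewrite !inE eqxx.
have [|K KS vK] := @componentP (~: [set x]) v; first by rewrite !inE.
have sK : K \subset ~: C.
  apply/subsetP => w wK; rewrite inE; apply/negP => wC.
  by move: vC; rewrite inE (component_eq CS KS wC wK) vK.
have [z zK axz] := component_neighbor cG KS.
apply: connect_trans (connect_in_sub sK (component_connect KS vK zK)) _.
by apply: connect1; rewrite /adj_in adjC axz xC (subsetP sK).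
Qed.

Lemma connected_setT : connected G ->
  {in [set: V] &, forall x y, connect (adj_in setT) x y}.
Proof.
move=> [_ cG] x y _ _; apply: connect_sub (cG x y) => u v a.
by apply: connect1; rewrite /adj_in !inE.
Qed.

Lemma sum_components S (F : V -> nat) :
  \sum_(K in components S) \sum_(v in K) F v = \sum_(v in S) F v.
Proof. by rewrite (set_partition_big _ (components_partition S)). Qed.

Lemma sum_mem_components S v : \sum_(K in components S) (v \in K) = (v \in S).
Proof.
rewrite -sum_eq_mem -sum_components.
by apply: eq_bigr => K _; rewrite sum_eq_mem.
Qed.

(** * Orientations and the edges between a vertex and a component *)

Lemma exists_orientation : exists O, orientation O.
Proof.
apply: (@fin_all_exists _ (fun=> _) (fun e p => ends e = [set p.1; p.2])) => e.
have /eqP/cards2P[x [y [_ ->]]] := card_ends e.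
by exists (x, y).
Qed.

Definition flip e O : E -> V * V :=
  fun f => if f == e then ((O f).2, (O f).1) else O f.

Lemma orientation_flip e O : orientation O -> orientation (flip e O).
Proof. by move=> oO f; rewrite /flip; case: eqP => _; rewrite oO //= setUC. Qed.

Definition outs O x C := #|[set e | ((O e).1 == x) && ((O e).2 \in C)]|.
Definition ins O x C := #|[set e | ((O e).2 == x) && ((O e).1 \in C)]|.

Lemma orientation_neq O e : orientation O -> (O e).1 != (O e).2.
Proof. by move=> /(_ e)/ends_neq. Qed.

Lemma mem_ends O e v : orientation O ->
  (v \in ends e) = (v == (O e).1) || (v == (O e).2).
Proof. by move=> ->; rewrite !inE. Qed.

Lemma eq_outdeg O O' v : orientation O -> orientation O' ->
  (forall e, v \in ends e -> O' e = O e) -> outdeg O' v = outdeg O v.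
Proof.
move=> oO oO' eqO; apply: eq_card => e; rewrite !inE.
case ve: (v \in ends e); first by rewrite eqO.
have := ve; rewrite (mem_ends _ _ oO) => /negbT/norP[/negbTE n1 _].
have := ve; rewrite (mem_ends _ _ oO') => /negbT/norP[/negbTE n2 _].
by rewrite ![_ == v]eq_sym n1 n2.
Qed.

Lemma eq_outs O O' x C : orientation O -> orientation O' ->
  (forall e, x \in ends e -> ~~ [disjoint ends e & C] -> O' e = O e) ->
  outs O' x C = outs O x C.
Proof.
move=> oO oO' eqO; apply: eq_card => e; rewrite !inE.
have [/andP[xe dj]|] := boolP ((x \in ends e) && ~~ [disjoint ends e & C]).
  by rewrite eqO.
have aux Q : orientation Q ->
    ~~ ((x \in ends e) && ~~ [disjoint ends e & C]) ->
    ((Q e).1 == x) && ((Q e).2 \in C) = false.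
  move=> oQ; apply: contraNF => /andP[/eqP <- qC].
  rewrite oQ !inE eqxx /=; apply/pred0Pn; exists (Q e).2.
  by rewrite !inE eqxx orbT.
by move=> n; rewrite !aux.
Qed.

(** Reversing every edge turns [ins] into [outs]. *)
Lemma eq_ins O O' x C : orientation O -> orientation O' ->
  (forall e, x \in ends e -> ~~ [disjoint ends e & C] -> O' e = O e) ->
  ins O' x C = ins O x C.
Proof.
move=> oO oO' eqO.
pose rv Q e : V * V := ((Q e).2, (Q e).1).
have orv Q : orientation Q -> orientation (rv Q).
  by move=> oQ e; rewrite oQ setUC.
apply: (@eq_outs (rv O) (rv O') x C); try exact: orv.
by move=> e xe dj; rewrite /rv eqO.
Qed.

Lemma sum_outdeg O S : \sum_(v in S) outdeg O v = \sum_e ((O e).1 \in S).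
Proof.
under eq_bigr do rewrite /outdeg card_set_sum.
rewrite exchange_big; apply: eq_bigr => e _ /=; rewrite -sum_eq_mem.
by apply: eq_bigr => v _; rewrite eq_sym.
Qed.

Lemma sum_outdegT O : \sum_v outdeg O v = num_edges G.
Proof.
transitivity (\sum_(v in [set: V]) outdeg O v).
  by apply: eq_bigl => v; rewrite inE.
by rewrite sum_outdeg /num_edges -sum1_card; apply: eq_bigr => e _; rewrite inE.
Qed.

(** Since [C] is a component of [G - x], an edge with tail in [C] has its head in [C] or at [x]. *)
Lemma sum_outdeg_component O x C : orientation O ->
  C \in components (~: [set x]) ->
  \sum_(v in C) outdeg O v = num_edges_in C + ins O x C.
Proof.
move=> oO CS; rewrite sum_outdeg /num_edges_in /ins !card_set_sum -big_split /=.
apply: eq_bigr => e _; rewrite oO subUset !sub1set.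
case tC: ((O e).1 \in C) => //=; last by rewrite andbF.
rewrite andbT; have [hx|hx] := eqVneq (O e).2 x.
  have /negbTE-> // : (O e).2 \notin C.
  by apply/negP => /(component_mem CS); rewrite hx !inE eqxx.
by rewrite (component_adj CS tC) ?inE // (ends_adj (oO e)).
Qed.

Lemma deg_toE O x C : orientation O -> x \notin C ->
  deg_to x C = outs O x C + ins O x C.
Proof.
move=> oO xC; rewrite /deg_to /outs /ins !card_set_sum -big_split /=.
apply: eq_bigr => e _; have /negbTE nth := orientation_neq e oO.
rewrite oO; apply/eqP; rewrite eq_sym; apply/eqP.
have [tx|tx] := eqVneq (O e).1 x; rewrite /=.
  rewrite tx (negbTE xC) andbF addn0; congr nat_of_bool; apply/idP/exists_inP.
    by move=> hC; exists (O e).2.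
  case=> y yC /eqP/setP/(_ (O e).2); rewrite !inE eqxx orbT => /esym.
  by rewrite -tx eq_sym nth => /eqP->.
rewrite add0n; congr nat_of_bool; apply/andP/exists_inP.
  by case=> /eqP hx tC; exists (O e).1 => //; rewrite hx setUC.
case=> y yC /eqP/setP eE.
have := eE (O e).1; rewrite !inE eqxx (negbTE tx) /= => /esym/eqP ty.
have := eE x; rewrite !inE eqxx eq_sym (negbTE tx) eq_sym /= => ->.
by rewrite ty.
Qed.

Lemma not_mem_component x C : C \in components (~: [set x]) -> x \notin C.
Proof. by move=> CS; apply/negP => /(component_mem CS); rewrite !inE eqxx. Qed.

Lemma outdegE O x : orientation O ->
  outdeg O x = \sum_(K in components (~: [set x])) outs O x K.
Proof.
move=> oO; rewrite /outdeg /outs card_set_sum.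
under [RHS]eq_bigr do rewrite card_set_sum.
rewrite exchange_big; apply: eq_bigr => e _ /=.
have [tx|_] := eqVneq (O e).1 x; last by rewrite big1.
rewrite sum_mem_components !inE -tx eq_sym.
by rewrite (orientation_neq e oO).
Qed.

Lemma degE x : deg x = \sum_(K in components (~: [set x])) deg_to x K.
Proof.
have [O oO] := exists_orientation.
transitivity (outdeg O x + \sum_(K in components (~: [set x])) ins O x K).
  rewrite /deg /outdeg /ins !card_set_sum.
  under [X in _ + X]eq_bigr do rewrite card_set_sum.
  rewrite exchange_big -big_split /=; apply: eq_bigr => e _ /=.
  rewrite (mem_ends _ _ oO) ![x == _]eq_sym.
  have /negbTE nth := orientation_neq e oO.
  have [hx|_] := eqVneq (O e).2 x; last by rewrite big1 // orbF addn0.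
  by rewrite sum_mem_components !inE -hx nth.
rewrite outdegE // -big_split /=; apply: eq_bigr => K KS.
by rewrite (deg_toE oO) // not_mem_component.
Qed.
Lemma outdeg_le_deg O v : orientation O -> outdeg O v <= deg v.
Proof.
move=> oO; apply: subset_leq_card; apply/subsetP => e; rewrite !inE => /eqP <-.
by rewrite oO !inE eqxx.
Qed.

Lemma outdeg_flip O e v :
  outdeg (flip e O) v + ((O e).1 == v) = outdeg O v + ((O e).2 == v).
Proof.
rewrite /outdeg !card_set_sum (bigD1 e) //= [in RHS](bigD1 e) //= /flip eqxx /=.
rewrite (eq_bigr (fun f => nat_of_bool ((O f).1 == v))); first by lia.
by move=> f /negbTE->.
Qed.

Lemma outs_flip O e x C :
  outs (flip e O) x C + (((O e).1 == x) && ((O e).2 \in C)) =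
  outs O x C + (((O e).2 == x) && ((O e).1 \in C)).
Proof.
rewrite /outs !card_set_sum (bigD1 e) //= [in RHS](bigD1 e) //= /flip eqxx /=.
rewrite (eq_bigr (fun f => nat_of_bool (((O f).1 == x) && ((O f).2 \in C)))).
  by lia.
by move=> f /negbTE->.
Qed.

Lemma deg_to_gt0 x C : connected G -> C \in components (~: [set x]) ->
  0 < deg_to x C.
Proof.
move=> cG CS; have [z zC /existsP[e eE]] := component_neighbor cG CS.
by apply/card_gt0P; exists e; rewrite inE; apply/exists_inP; exists z.
Qed.

Lemma ends_disjoint_component x C K e : C \in components (~: [set x]) ->
  K \in components (~: [set x]) -> C != K -> ~~ [disjoint ends e & C] ->
  [disjoint ends e & K].
Proof.
move=> CS KS nCK /pred0Pn[u /andP[/= ue uC]].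
apply/pred0P => v /=; apply/negP => /andP[/= ve vK].
have uv : u != v.
  apply: contraNneq nCK => uv; apply/eqP.
  by apply: (component_eq CS KS uC); rewrite uv.
have eE : ends e = [set u; v].
  apply/esym/eqP; rewrite eqEcard card_ends cards2 uv andbT.
  by apply/subsetP => w; rewrite !inE => /orP[]/eqP->.
have vC := component_adj CS uC (component_mem KS vK) (ends_adj eE).
by move: nCK; rewrite (component_eq CS KS vC vK) eqxx.
Qed.

Lemma disjoint_ends_nsub e C : [disjoint ends e & C] -> ~~ (ends e \subset C).
Proof.
rewrite disjoints_subset => sC'; apply/negP => sC; have := card_ends e.
suff -> : ends e = set0 by rewrite cards0.
by apply/eqP; rewrite -subset0 -(setICr C) subsetI sC.
Qed.

(** Direct all edges between [x] and [C] towards [x], then flip them one at a time. *)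
Lemma exists_outs O x C j : orientation O -> x \notin C -> j <= deg_to x C ->
  exists O', [/\ orientation O',
    forall e, [disjoint ends e & C] -> O' e = O e & outs O' x C = j].
Proof.
move=> oO xC; elim: j => [|j IH] jd.
  pose O' f := if ((O f).1 == x) && ((O f).2 \in C)
    then ((O f).2, (O f).1) else O f.
  have oO' : orientation O'.
    by move=> e; rewrite /O'; case: ifP => _; rewrite oO //= setUC.
  exists O'; split=> // [e dj|].
    rewrite /O'; case: ifP => // /andP[_ hC]; case/pred0Pn: dj.
    by exists (O e).2; rewrite /= hC oO !inE eqxx orbT.
  apply/eqP; rewrite cards_eq0; apply/eqP/setP => e; rewrite !inE /O'.
  case: ifP => [/andP[/eqP <- hC]|-> //] /=.
  by rewrite eq_sym (negbTE (orientation_neq e oO)).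
have [O1 [oO1 agO1 outO1]] := IH (ltnW jd).
have : 0 < ins O1 x C by move: jd; rewrite (deg_toE oO1 xC) outO1; lia.
case/card_gt0P => e; rewrite inE => /andP[hx tC].
exists (flip e O1); split; first exact: orientation_flip.
  move=> f dj; rewrite /flip; case: eqP => [fe|_]; last exact: agO1.
  case/pred0Pn: dj; exists (O1 f).1.
  by rewrite fe /= tC oO1 !inE eqxx.
have := outs_flip O1 e x C; rewrite hx tC outO1 /=.
have /negbTE-> : (O1 e).1 != x by rewrite -(eqP hx) orientation_neq.
by rewrite /= addn0 addn1.
Qed.

(** * The counters of a trace as sums over components *)

(** When all of [K] has its assigned parities, [l_contrib] is the residue modulo 2 of [outs O x K],
    and [t_contrib] that of [ins O x K]. They are thus also the least values that parity permits. *)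
Definition l_contrib (V1 : {set V}) x K : bool :=
  odd (#|K :&: V1| + num_edges_in K + deg_to x K).
Definition t_contrib (V1 : {set V}) K : bool :=
  odd (#|K :&: V1| + num_edges_in K).

Lemma trace_lE V1 V2 x : trace_l V1 V2 x =
  \sum_(K in components (~: [set x]) | K \subset V1 :|: V2) l_contrib V1 x K.
Proof.
rewrite /trace_l -sum1_card big_mkcond [RHS]big_mkcond; apply: eq_bigr => K _.
rewrite inE neq_mod2 -/(l_contrib V1 x K).
by case: (K \in _); case: (K \subset _); case: (l_contrib _ _ _).
Qed.

Lemma trace_tE V1 V2 x : trace_t V1 V2 x =
  \sum_(K in components (~: [set x]) | K \subset V1 :|: V2) t_contrib V1 K.
Proof.
rewrite /trace_t -sum1_card big_mkcond [RHS]big_mkcond; apply: eq_bigr => K _.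
rewrite inE neq_mod2 -/(t_contrib V1 K).
by case: (K \in _); case: (K \subset _); case: (t_contrib _ _).
Qed.

Lemma component_parity O x K (V1 : {set V}) : orientation O ->
  K \in components (~: [set x]) ->
  {in K, forall v, odd (outdeg O v) = (v \in V1)} ->
  odd #|K :&: V1| = odd (num_edges_in K + ins O x K).
Proof.
by move=> oO KS par; rewrite -(odd_sum_mem par) (sum_outdeg_component oO KS).
Qed.

Lemma l_contribE O x K (V1 : {set V}) : orientation O ->
  K \in components (~: [set x]) ->
  odd #|K :&: V1| = odd (num_edges_in K + ins O x K) ->
  l_contrib V1 x K = odd (outs O x K).
Proof.
move=> oO /not_mem_component xK; rewrite /l_contrib (deg_toE oO xK) !oddD => ->.
by case: (odd _); case: (odd _); case: (odd _).
Qed.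

(** A number is at least its residue modulo 2. Summed over the processed components, this bounds the
    out-degree of [x] below by [trace_l] and its in-degree below by [trace_t]. *)
Lemma outdeg_in_window O x (V1 V2 : {set V}) : orientation O ->
  {in V1 :|: V2, forall v, odd (outdeg O v) = (v \in V1)} ->
  in_window V1 V2 x (outdeg O x).
Proof.
move=> oO par; have parK K : K \in components (~: [set x]) ->
    K \subset V1 :|: V2 -> odd #|K :&: V1| = odd (num_edges_in K + ins O x K).
  move=> KS KP; apply: component_parity => // v vK.
  by apply: par; exact: subsetP KP v vK.
split.
  rewrite trace_lE outdegE // big_mkcondr; apply: leq_sum => K KS.
  case: ifP => // KP; rewrite (l_contribE oO KS (parK _ KS KP)).
  by case: (outs O x K) => // n; exact: leq_trans (leq_b1 _) _.
rewrite trace_tE outdegE // degE big_mkcondr -big_split; apply: leq_sum => K KS.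
rewrite (deg_toE oO (not_mem_component KS)) leq_add2l.
case: ifP => // KP; rewrite /t_contrib oddD parK // oddD addbAC addbb /=.
by case: (ins O x K) => // n; exact: leq_trans (leq_b1 _) _.
Qed.

(** * Good vertices and the transport of badness *)

Variable H : V -> nat -> Prop.
Definition good O v : bool := `[< H v (outdeg O v) >].

Lemma goodP O v : reflect (H v (outdeg O v)) (good O v).
Proof. exact: asboolP. Qed.

Lemma eq_good O O' v : orientation O -> orientation O' ->
  (forall e, v \in ends e -> O' e = O e) -> good O' v = good O v.
Proof. by move=> oO oO' eqO; rewrite /good (eq_outdeg oO oO' eqO). Qed.

Hypothesis dH : dense H.
Let cG : connected G := proj1 dH.

(** The flip changes the out-degree of [v] by exactly one, and by density two consecutive integers
    in [[0, deg v]] cannot both miss [H v]. *)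
Lemma flip_good O e v : orientation O -> v \in ends e -> ~~ good O v ->
  good (flip e O) v.
Proof.
move=> oO ve /negP ng; apply: contraT => /negP ng'; exfalso.
have := outdeg_flip O e v; have := orientation_neq e oO.
have lt O' := @outdeg_le_deg O' v.
have ltf := lt _ (orientation_flip e oO); have {}lt := lt _ oO.
move: ve; rewrite (mem_ends _ _ oO) => /orP[]/eqP ve; rewrite -ve eqxx.
  rewrite eq_sym => /negbTE->; rewrite addn1 addn0 => od.
  apply: ng; apply/goodP; rewrite -od; apply: (proj2 dH).
    by rewrite od.
  by move=> h; apply/ng'/goodP.
move=> /negbTE->; rewrite addn1 addn0 => od.
apply: ng'; apply/goodP; rewrite od; apply: (proj2 dH).
  by rewrite -od.
by move=> h; apply/ng/goodP.
Qed.

Lemma flip_good_other O e v : orientation O -> v \notin ends e ->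
  good (flip e O) v = good O v.
Proof.
move=> oO ve; apply: eq_good => // [|f vf]; first exact: orientation_flip.
by rewrite /flip; case: eqP vf ve => // -> ->.
Qed.

(* Flipping an edge at a bad vertex repairs that vertex and can spoil only the
   other end; so badness travels along paths. *)
Lemma move_bad O S x p : orientation O -> path (adj_in S) x p ->
  exists O', [/\ orientation O',
    forall e, ~~ (ends e \subset S) -> O' e = O e &
    forall v, v != last x p -> ~~ good O' v -> ~~ good O v && (v != x)].
Proof.
elim: p x O => [|z p IH] x O oO /=.
  by exists O; split=> // v ->; rewrite andbT.
case/andP=> /and3P[xS zS /existsP[e /eqP eE]] pp.
case gx: (good O x).
  exists O; split=> // v _ bv; rewrite bv; apply: contraNneq bv => ->.
  by rewrite gx.
have [O' [oO' agO' bO']] := IH z (flip e O) (orientation_flip e oO) pp.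
exists O'; split=> // [f fS|v vl bv].
  rewrite agO' // /flip; case: eqP fS => // ->.
  by rewrite eE subUset !sub1set xS zS.
case/andP: (bO' v vl bv) => bfv vz.
have vx : v != x.
  apply: contraNneq bfv => ->; apply: flip_good => //; last by rewrite gx.
  by rewrite eE !inE eqxx.
rewrite vx andbT -(@flip_good_other O e) //.
by rewrite eE !inE negb_or vx.
Qed.

(** Moving the badness of a vertex along a path to [y] lowers the number of bad vertices of [S]
    other than [y]. *)
Lemma concentrate_bad O S y : orientation O ->
  {in S, forall x, connect (adj_in S) x y} ->
  exists O', [/\ orientation O',
    forall e, ~~ (ends e \subset S) -> O' e = O e &
    forall v, v \in S -> v != y -> good O' v].
Proof.
move=> oO cS; have [n] := ubnP #|[set v in S | (v != y) && ~~ good O v]|.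
elim: n O oO => // n IH O oO; rewrite ltnS => le_n.
case: (pickP [pred v in S | (v != y) && ~~ good O v]) => [x|none]; last first.
  exists O; split=> // v vS vy; have := none v; rewrite /= vS vy /=.
  by move/negbFE.
move=> /and3P[/= xS xy bx]; case/connectP: (cS _ xS) => p pp yE.
have [O1 [oO1 agO1 bO1]] := move_bad oO pp; rewrite -yE in bO1.
have [|O2 [oO2 agO2 gO2]] := IH O1 oO1.
  apply: leq_trans le_n; apply: proper_card; apply/properP; split.
    apply/subsetP => v; rewrite !inE => /and3P[-> vy bv]; rewrite vy /=.
    by case/andP: (bO1 v vy bv).
  exists x; rewrite !inE xS xy //=; apply/negP => bx1.
  by have := bO1 x xy bx1; rewrite eqxx andbF.
by exists O2; split=> // e eS; rewrite agO2 // agO1.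
Qed.

(** * The two invariants of the processed set *)

Definition parity_sound (V1 V2 : {set V}) : Prop := forall O, orientation O ->
  {in V1 :|: V2, forall v, good O v} ->
  {in V1 :|: V2, forall v, odd (outdeg O v) = (v \in V1)}.

(** A converse to [component_parity]: the parity of the edges from [C] to [x] is the only
    obstruction to making [C] good from the inside. *)
Definition component_solvable (V1 V2 : {set V}) : Prop :=
  forall O x C, orientation O -> x \notin V1 :|: V2 ->
  C \in components (~: [set x]) -> C \subset V1 :|: V2 ->
  odd #|C :&: V1| = odd (num_edges_in C + ins O x C) ->
  exists O', [/\ orientation O',
    forall e, ~~ (ends e \subset C) -> O' e = O e &
    {in C, forall v, good O' v}].

(** Concentrate the badness of [C] at [y], then the badness outside [C] at [x]. The vertices of [C]
    other than [y] then have the parities given by [V1], so the parity of the out-degree sum over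
    [C] settles that of [y]. *)
Lemma solve_component (V1 : {set V}) O x y C : orientation O ->
  C \in components (~: [set x]) -> y \in C ->
  (forall O', orientation O' ->
    (forall v, v != x -> v != y -> good O' v) ->
    {in C, forall v, v != y -> odd (outdeg O' v) = (v \in V1)} /\
    (odd (outdeg O' y) = (y \in V1) -> good O' y)) ->
  odd #|C :&: V1| = odd (num_edges_in C + ins O x C) ->
  exists O', [/\ orientation O',
    forall e, ~~ (ends e \subset C) -> O' e = O e &
    {in C, forall v, good O' v}].
Proof.
move=> oO CS yC almost parC.
have xC := not_mem_component CS.
have [|O1 [oO1 agO1 gO1]] := concentrate_bad oO (S := C) (y := y).
  by move=> v vC; exact: (component_connect CS).
have [|O2 [oO2 agO2 gO2]] := concentrate_bad oO1 (S := ~: C) (y := x).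
  exact: setC_component_connect.
have eqC v : v \in C -> forall e, v \in ends e -> O2 e = O1 e.
  move=> vC e ve; apply: agO2; apply/subsetPn; exists v => //.
  by rewrite inE vC.
(* [O1] agrees with [O] off [C], while [O2] agrees with [O1] on every edge meeting [C]; so goodness
   on [C] can be checked in [O2]. *)
exists O1; split=> // v vC; have [vy|vy] := eqVneq v y; last exact: gO1.
rewrite -(eq_good oO1 oO2 (eqC v vC)) vy; have [|par gy] := almost O2 oO2.
  move=> w wx wy; case wC: (w \in C); last by apply: gO2; rewrite // inE wC.
  by rewrite (eq_good oO1 oO2 (eqC w wC)) gO1.
apply: gy; have : odd (\sum_(v in C) outdeg O2 v) = odd #|C :&: V1|.
  rewrite (sum_outdeg_component oO2 CS) parC; congr (odd (_ + _)).
  apply: eq_ins => // e xe /pred0Pn[w /andP[/= we wC]].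
  rewrite (eqC w wC) // agO1 //; apply/subsetPn; by exists x.
(* With both sides written as sums over [C], the terms other than [y] cancel modulo 2. *)
rewrite -(odd_sum_mem (A := C) (F := fun v => v \in V1 : nat)); last first.
  by move=> w _; case: (w \in V1).
rewrite (bigD1 y) //= [X in _ = odd X](bigD1 y) //= !oddD !odd_sum.
rewrite (eq_bigr (fun v => odd (v \in V1))).
  by move/addIb => ->; case: (y \in V1).
by move=> w /andP[wC wy]; rewrite par //; case: (w \in V1).
Qed.

(** The old parities place the out-degree of [y] in its window, where [H y] has only the assigned
    parity. *)
Lemma parity_sound_step (V1 V2 W1 W2 : {set V}) y : parity_sound V1 V2 ->
  y \notin V1 :|: V2 -> W1 :|: W2 = y |: (V1 :|: V2) ->
  (forall v, v != y -> (v \in W1) = (v \in V1)) ->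
  (forall i, in_window V1 V2 y i -> H y i -> odd i = (y \in W1)) ->
  parity_sound W1 W2.
Proof.
move=> snd yP WE W1E sy O oO; rewrite WE => gO.
have par : {in V1 :|: V2, forall v, odd (outdeg O v) = (v \in V1)}.
  by apply: snd => // v vP; apply: gO; rewrite in_setU1 vP orbT.
move=> v; rewrite in_setU1 => /orP[/eqP->|vP].
  apply: sy; first exact: outdeg_in_window.
  by apply/goodP; apply: gO; rewrite !inE eqxx.
by rewrite par // W1E //; apply: contraNneq yP => <-.
Qed.

(** Only [y] in [C] is new. An orientation good off [x] and [y] is good on the old processed set, so
    the out-degree of [y] lies in its window, where [H y] contains the whole assigned parity
    class. *)
Lemma component_solvable_step (V1 V2 W1 W2 : {set V}) y : parity_sound V1 V2 ->
  component_solvable V1 V2 ->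
  y \notin V1 :|: V2 -> W1 :|: W2 = y |: (V1 :|: V2) ->
  (forall v, v != y -> (v \in W1) = (v \in V1)) ->
  (forall i, in_window V1 V2 y i -> odd i = (y \in W1) -> H y i) ->
  component_solvable W1 W2.
Proof.
move=> snd slv yP WE W1E fy O x C oO; rewrite WE in_setU1 negb_or.
move=> /andP[xy xP] CS CP parC; case yC: (y \in C).
  apply: (solve_component oO CS yC _ parC) => O' oO' gO'.
  have par : {in V1 :|: V2, forall v, odd (outdeg O' v) = (v \in V1)}.
    apply: snd => // v vP; apply: gO'; first by apply: contraNneq xP => <-.
    by apply: contraNneq yP => <-.
  split=> [v vC vy|py].
    rewrite W1E // par //; have := subsetP CP v vC.
    by rewrite in_setU1 (negbTE vy).
  by apply/goodP; apply: fy py; exact: outdeg_in_window.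
have CP' : C \subset V1 :|: V2.
  apply/subsetP => v vC; have := subsetP CP v vC; rewrite in_setU1.
  by case: eqP vC => // ->; rewrite yC.
apply: (slv O x) => //; rewrite -parC; congr (odd #|pred_of_set _|).
apply/setP => v; rewrite !in_setI; case vC: (v \in C) => //=.
by rewrite W1E //; apply: contraTneq vC => ->; rewrite yC.
Qed.

(** * Density inside an interval of out-degrees *)

(** If [j] were missing from [H v], density would put its neighbour on the side of [i] into [H v],
    with the wrong parity. *)
Lemma dense_uniform v m n i j p : n <= deg v ->
  (forall k, m <= k <= n -> H v k -> odd k = p) ->
  m <= i <= n -> H v i -> m <= j <= n -> odd j = p -> H v j.
Proof.
move=> nd unif iw Hi jw jp; have ip := unif _ iw Hi.
apply: contrapT => nHj.
have [ij|ij|ij] := ltngtP i j; last by rewrite -ij in nHj.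
  have [|Hj] := pselect (H v j.-1).
    by move=> /(unif j.-1 ltac:(lia)); lia.
  apply: nHj; have -> : j = j.-1.+1 by lia.
  by apply: (proj2 dH) => //; lia.
have /unif : H v j.+1 by apply: (proj2 dH) => //; lia.
by lia.
Qed.

(** If [i.+1] is missing, density gives [i.+2]; steps of two from [i] keep the parity and cannot
    reach [j]. *)
Lemma dense_consecutive v i j : i < j -> j <= deg v -> H v i -> H v j ->
  odd i != odd j -> exists a, [/\ i <= a, a < j, H v a & H v a.+1].
Proof.
move=> ij jd Hi Hj par; have [n] := ubnP (j - i).
elim: n i ij Hi par => // n IH i ij Hi par le_n.
have [Hi1|nHi1] := pselect (H v i.+1); first by exists i.
have i1j : i.+1 < j.
  by rewrite ltn_neqAle ij andbT; apply: contra_notN nHi1 => /eqP ->.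
have i2j : i.+2 < j by lia.
have Hi2 : H v i.+2 by apply: (proj2 dH) => //; lia.
have [||a [ia aj Ha Ha1]] := IH i.+2 i2j Hi2; [by lia|by lia|].
by exists a; split=> //; lia.
Qed.

(** If the window meets [H y], [dense_uniform] gives the converse inclusion. Otherwise density
    leaves the window at most the integer [l], and taking [q] opposite to its parity makes both
    clauses vacuous. *)
Lemma exists_full_parity (V1 V2 : {set V}) y p :
  (forall i, in_window V1 V2 y i -> H y i -> odd i = p) ->
  exists q, (forall i, in_window V1 V2 y i -> H y i -> odd i = q) /\
            (forall i, in_window V1 V2 y i -> odd i = q -> H y i).
Proof.
rewrite /in_window; set l := trace_l _ _ _; set t := trace_t _ _ _ => unif.
have [[i iw Hi]|none] := pselect (exists2 i, l <= i /\ i + t <= deg y & H y i).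
  exists p; split=> // j jw jp.
  apply: (@dense_uniform y l (deg y - t) i j p) => //; try lia.
  by move=> k kw; apply: unif; lia.
have nH k : l <= k /\ k + t <= deg y -> ~ H y k.
  by move=> kw Hk; apply: none; exists k.
exists (~~ odd l); split=> i iw; first by move/(nH i iw).
move=> par; exfalso.
have li : l < i by rewrite ltn_neqAle; case: eqP par => [->|]; lia.
apply: (nH l.+1); first by lia.
by apply: (proj2 dH); [lia|apply: nH; lia].
Qed.

(* Concentrate the badness of [C] at the tail of an edge from [C] to [x], then
   flip that edge if necessary. *)
Lemma component_outs_dense x C j : C \in components (~: [set x]) ->
  j < deg_to x C ->
  exists O, [/\ orientation O, {in C, forall v, good O v} &
    j <= outs O x C <= j.+1].
Proof.
move=> CS jd; have xC := not_mem_component CS.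
have [O0 oO0] := exists_orientation.
have [O [oO _ outO]] := exists_outs oO0 xC (ltnW jd).
have : 0 < ins O x C by move: jd; rewrite (deg_toE oO xC) outO; lia.
case/card_gt0P => e; rewrite inE => /andP[/eqP hx zC].
have [|O1 [oO1 agO1 gO1]] := concentrate_bad oO (S := C) (y := (O e).1).
  by move=> v vC; exact: (component_connect CS).
have O1x f : x \in ends f -> O1 f = O f.
  by move=> xf; apply: agO1; apply/subsetPn; exists x.
have outO1 : outs O1 x C = j.
  by rewrite -outO; apply: eq_outs => // f xf _; exact: O1x.
have O1e : O1 e = O e by apply: O1x; rewrite oO hx !inE eqxx orbT.
have [gz|bz] := boolP (good O1 (O e).1).
  exists O1; split=> // [v vC|]; last by rewrite outO1; lia.
  by have [->//|vz] := eqVneq v (O e).1; exact: gO1.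
exists (flip e O1); split; first exact: orientation_flip.
  move=> v vC; have [->|vz] := eqVneq v (O e).1.
    by apply: (flip_good) => //; rewrite oO !inE eqxx.
  rewrite flip_good_other ?gO1 // oO hx !inE negb_or vz.
  by apply: contraNneq xC => <-.
have := outs_flip O1 e x C; rewrite outO1 O1e hx eqxx zC /=.
have /negbTE-> : (O e).1 != x by rewrite -hx orientation_neq.
by lia.
Qed.

(** * Assembling orientations from components *)

Lemma contribD (V1 : {set V}) x K :
  odd (l_contrib V1 x K + t_contrib V1 K) = odd (deg_to x K).
Proof.
rewrite oddD !oddb /l_contrib /t_contrib !oddD.
by case: (odd _); case: (odd _); case: (odd _).
Qed.

(** The left side has the parity of [deg_to x K], which is positive; so the degree is at least 2
    when both residues are 1. *)
Lemma contrib_le (V1 : {set V}) x K : K \in components (~: [set x]) ->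
  l_contrib V1 x K + t_contrib V1 K <= deg_to x K.
Proof.
move=> KS; have := deg_to_gt0 cG KS; have := contribD V1 x K.
by case: (l_contrib V1 x K); case: (t_contrib V1 K); lia.
Qed.

(** Induction on [s], with [split_count] sharing [b] between the head and the rest. No edge meets
    two components of [G - x], so adjusting one leaves the others intact. *)
Lemma fill_components V1 V2 x (s : seq {set V}) : component_solvable V1 V2 ->
  x \notin V1 :|: V2 -> uniq s ->
  {in s, forall K, (K \in components (~: [set x])) && (K \subset V1 :|: V2)} ->
  forall O b, orientation O -> \sum_(K <- s) l_contrib V1 x K <= b ->
  b + \sum_(K <- s) t_contrib V1 K <= \sum_(K <- s) deg_to x K ->
  odd b = odd (\sum_(K <- s) l_contrib V1 x K) ->
  exists O', [/\ orientation O',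
    forall e, {in s, forall K, [disjoint ends e & K]} -> O' e = O e,
    {in s, forall K, {in K, forall v, good O' v}} &
    \sum_(K <- s) outs O' x K = b].
Proof.
move=> slv xP; elim: s => [|K s IH] us sP O b oO.
  by rewrite !big_nil => _ b0 _; exists O; split=> //; rewrite ?big_nil; lia.
case/andP: us => Ks us.
have /andP[KS KP] : (K \in components (~: [set x])) && (K \subset V1 :|: V2).
  by apply: sP; rewrite mem_head.
have {}sP : {in s, forall K,
    (K \in components (~: [set x])) && (K \subset V1 :|: V2)}.
  by move=> L Ls; apply: sP; rewrite inE Ls orbT.
have sum_le : \sum_(L <- s) l_contrib V1 x L + \sum_(L <- s) t_contrib V1 L
    <= \sum_(L <- s) deg_to x L.
  rewrite -big_split /= !big_seq; apply: leq_sum => L Ls.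
  by case/andP: (sP L Ls) => LS _; exact: contrib_le.
rewrite !big_cons => lb bu pb.
have [f [lfb ft pf [lbf bft pbf]]] :=
  split_count (contrib_le V1 KS) (contribD V1 x K) sum_le lb bu pb.
have [O1 [oO1 agO1 gO1 outO1]] := IH us sP O (b - f) oO lbf bft pbf.
have xK := not_mem_component KS.
have fd : f <= deg_to x K by lia.
have [O2 [oO2 agO2 outO2]] := exists_outs oO1 xK fd.
have [|O3 [oO3 agO3 gO3]] := slv O2 x K oO2 xP KS KP.
  (* As [f] has the parity of [l_contrib], the edges from [K] to [x] have the parity that
     solvability asks for. *)
  have : odd f = l_contrib V1 x K by rewrite pf oddb.
  rewrite -outO2 /l_contrib (deg_toE oO2 xK) !oddD.
  by case: (odd _); case: (odd _); case: (odd _); case: (odd _).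
have agK e : [disjoint ends e & K] -> O3 e = O1 e.
  by move=> dj; rewrite agO3 ?agO2 //; exact: disjoint_ends_nsub.
have agL L e : L \in s -> ~~ [disjoint ends e & L] -> O3 e = O1 e.
  move=> Ls dj; apply: agK; case/andP: (sP L Ls) => LS _.
  by apply: (ends_disjoint_component LS KS _ dj); apply: contraNneq Ks => <-.
exists O3; split=> // [e djs|L|].
- rewrite agK; last by apply: djs; rewrite mem_head.
  by apply: agO1 => L Ls; apply: djs; rewrite inE Ls orbT.
- rewrite inE => /orP[/eqP->//|Ls] v vL.
  rewrite (eq_good oO1 oO3); first exact: gO1 Ls v vL.
  by move=> e ve; apply: (agL L) => //; apply/pred0Pn; exists v; rewrite /= ve.
rewrite big_cons.
have -> : outs O3 x K = f.
  rewrite -outO2; apply: eq_outs => // e xe _; apply: agO3.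
  by apply/subsetPn; exists x.
have -> : \sum_(L <- s) outs O3 x L = b - f.
  rewrite -outO1 !big_seq; apply: eq_bigr => L Ls; apply: eq_outs => // e _.
  exact: agL.
by lia.
Qed.

Lemma H_orientation_components O x : orientation O -> H x (outdeg O x) ->
  {in components (~: [set x]), forall K, {in K, forall v, good O v}} ->
  H_orientation H O.
Proof.
move=> oO Hx gO; split=> // v; have [->//|vx] := eqVneq v x.
have [|K KS vK] := @componentP (~: [set x]) v; first by rewrite !inE.
by apply/goodP; exact: gO KS v vK.
Qed.

(** Counted as the sum of out-degrees of an arbitrary orientation. *)
Lemma num_edgesE x : num_edges G =
  \sum_(K in components (~: [set x])) (num_edges_in K + deg_to x K).
Proof.
have [O oO] := exists_orientation.
rewrite -(sum_outdegT O) (bigD1 x) //= outdegE //.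
have -> : \sum_(v | v != x) outdeg O v = \sum_(v in ~: [set x]) outdeg O v.
  by apply: eq_bigl => v; rewrite !inE.
rewrite -sum_components -big_split /=; apply: eq_bigr => K KS.
rewrite (sum_outdeg_component oO KS) (deg_toE oO (not_mem_component KS)).
by lia.
Qed.

Lemma sum_card_component x (V1 : {set V}) : x \notin V1 ->
  \sum_(K in components (~: [set x])) #|K :&: V1| = #|V1|.
Proof.
move=> xV; have cardI (A : {set V}) : #|A :&: V1| = \sum_(v in A) (v \in V1).
  rewrite -sum1_card big_mkcond [RHS]big_mkcond; apply: eq_bigr => v _.
  by rewrite inE; case: (v \in A); case: (v \in V1).
under eq_bigr do rewrite cardI.
rewrite sum_components -cardI; congr #|pred_of_set _|; apply/setIidPr.
by rewrite -disjoints_subset disjoint_sym disjoints1.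
Qed.

(** Every component of [G - x] is processed, so [fill_components] applies to all of them; the sum of
    the [l_contrib] is congruent to [#|V1| + num_edges G]. *)
Lemma orient_last V1 V2 x i : component_solvable V1 V2 ->
  V1 :|: V2 = ~: [set x] -> in_window V1 V2 x i -> H x i ->
  odd i = odd (#|V1| + num_edges G) -> exists O, H_orientation H O.
Proof.
move=> slv PE [li it] Hi pi; have [O oO] := exists_orientation.
have xP : x \notin V1 :|: V2 by rewrite PE !inE eqxx.
have allP F : \sum_(K in components (~: [set x]) | K \subset V1 :|: V2) F K =
    \sum_(K <- enum (components (~: [set x]))) F K :> nat.
  rewrite big_enum; apply: eq_bigl => K; case KS: (K \in _) => //=.
  by rewrite PE (sub_component KS).
move: li it; rewrite trace_lE trace_tE !allP degE -big_enum => li it.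
have sP : {in enum (components (~: [set x])), forall K,
    (K \in components (~: [set x])) && (K \subset V1 :|: V2)}.
  by move=> K; rewrite mem_enum => KS; rewrite KS PE sub_component.
have [|O' [oO' _ gO' outO']] :=
  fill_components slv xP (enum_uniq _) sP oO li it.
  rewrite pi (num_edgesE x) big_enum -(@sum_card_component x); last first.
    by apply: contra xP; rewrite inE => ->.
  rewrite -big_split /= !odd_sum; apply: eq_bigr => K _.
  by rewrite oddb /l_contrib addnA.
exists O'; apply: (@H_orientation_components _ x) => //.
  by rewrite outdegE // -big_enum outO'.
by move=> K KS; apply: gO'; rewrite mem_enum.
Qed.

Lemma orient_two_parities V1 V2 x C a : component_solvable V1 V2 ->
  x \notin V1 :|: V2 -> C \in components (~: [set x]) ->
  ~~ (C \subset V1 :|: V2) ->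
  {in components (~: [set x]), forall K, K != C -> K \subset V1 :|: V2} ->
  in_window V1 V2 x a -> in_window V1 V2 x a.+1 -> H x a -> H x a.+1 ->
  exists O, H_orientation H O.
Proof.
move=> slv xP CS CP KP [la _] [_ at1] Ha Ha1.
pose s := enum [set K in components (~: [set x]) | K \subset V1 :|: V2].
have sumP F : \sum_(K in components (~: [set x]) | K \subset V1 :|: V2) F K =
    \sum_(K <- s) F K :> nat.
  by rewrite /s big_enum; apply: eq_bigl => K; rewrite inE.
have sumC F : \sum_(K in components (~: [set x])) F K =
    F C + \sum_(K <- s) F K :> nat.
  rewrite (bigD1 C) //= -sumP; congr (_ + _); apply: eq_bigl => K.
  case KS: (K \in _) => //=; have [->|nKC] := eqVneq K C; last by rewrite KP.
  by rewrite (negbTE CP).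
move: la at1; rewrite trace_lE trace_tE !sumP degE sumC.
set l := (\sum_(K <- s) l_contrib V1 x K).
set t := (\sum_(K <- s) t_contrib V1 K).
set d := (\sum_(K <- s) deg_to x K) => la at1.
have ltd : l + t <= d.
  rewrite /l /t /d -big_split /= !big_seq; apply: leq_sum => K.
  by rewrite mem_enum inE => /andP[KS _]; exact: contrib_le.
have ltd_odd : odd (l + t) = odd d.
  rewrite /l /t /d -big_split /= !odd_sum.
  by apply: eq_bigr => K _; exact: contribD.
have d0 := deg_to_gt0 cG CS.
(* The truncated difference [a - (d - t)] is the least number of edges into [C] that leaves at most
   [d - t] of the [a] out-edges to the processed components. *)
have jd : a - (d - t) < deg_to x C by lia.
have [O0 [oO0 gO0 outO0]] := component_outs_dense CS jd.
move: outO0; set c := outs O0 x C => outO0.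
(* With [c] edges going into [C], exactly one of the totals [a] and [a.+1] leaves a remainder with
   the parity of [l]; both totals lie in [H x]. *)
have [b [lb bt pb Hb]] : exists b,
    [/\ l <= b, b + t <= d, odd b = odd l & H x (c + b)].
  have [pa|pa] := boolP (odd (a + c) == odd l).
    exists (a - c); split; [lia|lia|lia|].
    by have -> : c + (a - c) = a by lia.
  exists (a.+1 - c); split; [lia|lia|lia|].
  by have -> : c + (a.+1 - c) = a.+1 by lia.
have sP : {in s, forall K,
    (K \in components (~: [set x])) && (K \subset V1 :|: V2)}.
  by move=> K; rewrite mem_enum inE.
have [O [oO agO gO outO]] :=
  fill_components slv xP (enum_uniq _) sP oO0 lb bt pb.
have agC e : ~~ [disjoint ends e & C] -> O e = O0 e.
  move=> dj; apply: agO => K /sP/andP[KS KP'].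
  apply: (ends_disjoint_component CS KS _ dj).
  by apply: contraNneq CP => ->.
exists O; apply: (@H_orientation_components _ x) => // [|K KS v vK].
  rewrite outdegE // sumC outO (_ : outs O x C = c) //.
  by apply: eq_outs => // e _; exact: agC.
have [KC|nKC] := eqVneq K C; last first.
  by apply: (gO K) => //; rewrite mem_enum inE KS KP.
move: vK; rewrite KC => vC; rewrite (eq_good oO0 oO); first exact: gO0.
by move=> e ve; apply: agC; apply/pred0Pn; exists v; rewrite /= ve.
Qed.

(** * Construction of a bad parity trace *)

(* Root at [r] and take [x] outside [P] whose deletion leaves the component of
   [r] as large as possible. *)
Lemma exists_extremal (P : {set V}) r : r \notin P ->
  exists2 x, x \notin P &
    {in components (~: [set x]) &, forall K L,
      ~~ (K \subset P) -> ~~ (L \subset P) -> K = L}.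
Proof.
move=> rP; pose Q x := (x \notin P) && (x != r).
case: (pickP Q) => [x0 x0P|none]; last first.
  exists r => // K L KS _ /subsetPn[v vK vP].
  by have := none v; have := component_mem KS vK; rewrite !inE /Q vP => ->.
pose comp_r x := [set v in ~: [set x] | connect (adj_in (~: [set x])) r v].
case: (@arg_maxnP _ x0 Q (fun x => #|comp_r x|) x0P).
move=> x /andP[xP xr] xmax; exists x => //.
have [|C CS rC] := @componentP (~: [set x]) r; first by rewrite !inE eq_sym.
suff onlyC K : K \in components (~: [set x]) -> ~~ (K \subset P) -> K = C.
  by move=> K L KS LS KP LP; rewrite (onlyC K) // (onlyC L).
(* If [r] were not in [K], then [y] would beat [x]: deleting [y] keeps all of [C] connected to [r],
   and [x] as well. *)
move=> KS /subsetPn[y yK yP]; apply: (component_eq KS CS) (rC).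
apply: contraT => rK; have yr : y != r by apply: contraNneq rK => <-.
have /xmax /= : Q y by rewrite /Q yP.
rewrite /geq /= leqNgt => /negP[]; apply: proper_card.
have yx : x != y.
  by apply: contraTneq (component_mem KS yK) => ->; rewrite !inE eqxx.
have yC : y \notin C.
  by apply: contra rK => yC; rewrite (component_eq KS CS yK yC).
have Cy : C \subset ~: [set y].
  by apply/subsetP => v vC; rewrite !inE; apply: contraNneq yC => <-.
have conC v : v \in C -> connect (adj_in (~: [set y])) r v.
  by move=> vC; apply: connect_in_sub Cy _; exact: (component_connect CS).
apply/properP; split.
  apply/subsetP => v; rewrite inE -(mem_component _ CS rC) => vC.
  by rewrite inE (subsetP Cy) // conC.
have [z zC axz] := component_neighbor cG CS.
exists x; last by rewrite !inE eqxx.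
rewrite !inE yx; apply: connect_trans (conC z zC) _; apply: connect1.
by rewrite /adj_in adjC axz (subsetP Cy) // !inE yx.
Qed.

(** A second unprocessed vertex singles out the one unfinished component [C]. Two window elements of
    [H x] of different parities would yield two consecutive ones, hence an [H]-orientation. *)
Lemma window_uniform V1 V2 x : (forall O, ~ H_orientation H O) ->
  component_solvable V1 V2 -> x \notin V1 :|: V2 ->
  #|~: (V1 :|: V2)| > 1 ->
  {in components (~: [set x]) &, forall K L,
    ~~ (K \subset V1 :|: V2) -> ~~ (L \subset V1 :|: V2) -> K = L} ->
  exists p, forall i, in_window V1 V2 x i -> H x i -> odd i = p.
Proof.
move=> noO slv xP Rgt1 uniqC.
have [y yP yx] : exists2 y, y \notin V1 :|: V2 & y != x.
  move: Rgt1; rewrite (cardsD1 x) inE xP ltnS => /card_gt0P[y].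
  by rewrite !inE => /andP[yx yP]; exists y; rewrite ?inE.
have [|C CS yC] := @componentP (~: [set x]) y; first by rewrite !inE.
have CP : ~~ (C \subset V1 :|: V2) by apply/subsetPn; exists y.
have KP : {in components (~: [set x]), forall K, K != C -> K \subset V1 :|: V2}.
  by move=> K KS; apply: contraR => KP; apply/eqP; apply: uniqC.
have noconsec i j : i < j -> in_window V1 V2 x i -> in_window V1 V2 x j ->
    H x i -> H x j -> odd i = odd j.
  move=> ij [li _] [_ jt] Hi Hj; apply/eqP; apply: contraT => pij; exfalso.
  have [|a [ia aj Ha Ha1]] := dense_consecutive ij _ Hi Hj pij; first by lia.
  have [O HO] := orient_two_parities slv xP CS CP KP (a := a)
    ltac:(split; lia) ltac:(split; lia) Ha Ha1.
  exact: noO HO.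
have [[i iw Hi]|none] := pselect (exists2 i, in_window V1 V2 x i & H x i).
  exists (odd i) => j jw Hj; have [ij|ij|->//] := ltngtP i j.
    by rewrite (noconsec i j).
  by rewrite (noconsec j i).
(* The window misses [H x], so any parity would do. *)
by exists true => i iw Hi; case: none; exists i.
Qed.

(** Induction on the number of unprocessed vertices, processing an extremal one first. *)
Lemma exists_parity_trace (V1 V2 : {set V}) : (forall O, ~ H_orientation H O) ->
  parity_sound V1 V2 -> component_solvable V1 V2 ->
  0 < #|~: (V1 :|: V2)| ->
  exists xs W1 W2, [/\ uniq xs, xs =i ~: (V1 :|: V2),
    trace_steps H V1 V2 xs W1 W2 & odd #|W1| != odd (num_edges G)].
Proof.
move=> noO; case En: #|_| => [//|n] + + _.
elim: n V1 V2 En => [|n IH] V1 V2 En snd slv.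
  have /eqP/cards1P[x RE] := En.
  have PE : V1 :|: V2 = ~: [set x] by rewrite -RE setCK.
  have xV : x \notin V1 by have := set11 x; rewrite -RE !inE => /norP[].
  (* At the last vertex [orient_last] excludes one parity; assigning the other makes the final count
     differ from the number of edges modulo 2. *)
  have unif i : in_window V1 V2 x i -> H x i ->
      odd i = ~~ odd (#|V1| + num_edges G).
    move=> iw Hi; apply/eqP; apply: contraT => pi; exfalso.
    have [|O] := orient_last slv PE iw Hi; last exact: noO.
    by move: pi; case: (odd i); case: (odd _).
  exists [:: x]; case pV: (odd (#|V1| + num_edges G)); rewrite pV in unif.
    exists V1, (x |: V2); split=> //; first by move=> v; rewrite RE !inE.
      by apply: trace_even; [move=> i iw Hi; rewrite unif|exact: trace_nil].
    by move: pV; rewrite oddD; case: (odd _); case: (odd _).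
  exists (x |: V1), V2; split=> //; first by move=> v; rewrite RE !inE.
    by apply: trace_odd; [move=> i iw Hi; rewrite unif|exact: trace_nil].
  by move: pV; rewrite cardsU1 xV oddD /=; case: (odd _); case: (odd _).
have /card_gt0P[r] : 0 < #|~: (V1 :|: V2)| by rewrite En.
rewrite inE => /exists_extremal[x xP uniqC].
have [|p unif] := window_uniform noO slv xP _ uniqC; first by rewrite En.
(* [p] is enough for a trace step, but preserving [component_solvable] needs [q], whose whole parity
   class in the window lies in [H x]. *)
have [q [sq fq]] := exists_full_parity unif.
pose W1 := if q then x |: V1 else V1; pose W2 := if q then V2 else x |: V2.
have WE : W1 :|: W2 = x |: (V1 :|: V2).
  by rewrite /W1 /W2; case: (q); [rewrite setUA|rewrite setUCA].
have xV : x \notin V1 by apply: contra xP; rewrite inE => ->.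
have W1E v : v != x -> (v \in W1) = (v \in V1).
  by move=> vx; rewrite /W1; case: (q) => //; rewrite !inE (negbTE vx).
have xW : (x \in W1) = q.
  by rewrite /W1; case: (q); rewrite ?(negbTE xV) // !inE eqxx.
have RE : ~: (W1 :|: W2) = ~: (V1 :|: V2) :\ x.
  by apply/setP => v; rewrite WE !inE negb_or.
have [|||xs [U1 [U2 [uxs xsE tr pU]]]] := IH W1 W2.
- by rewrite RE; move: En; rewrite (cardsD1 x) inE xP => -[].
- by apply: (parity_sound_step snd xP WE W1E); rewrite xW.
- by apply: (component_solvable_step snd slv xP WE W1E); rewrite xW.
exists (x :: xs), U1, U2; split=> //.
- by rewrite /= uxs xsE RE !inE eqxx.
- move=> v; rewrite inE xsE RE in_setD1; have [->|//] := eqVneq v x.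
  by rewrite inE xP.
by move: tr sq; rewrite /W1 /W2; case: (q) => tr sq;
  [apply: trace_odd tr|apply: trace_even tr] => i iw Hi; rewrite sq.
Qed.

(** * The initial sets of a trace *)

Lemma init_parity i v : v \in V1_init H :|: V2_init H -> i <= deg v -> H v i ->
  odd i = (v \in V1_init H).
Proof.
rewrite !inE.
case: (asboolP (H_odd H v)) => [[_ ho] _|_ /= /asboolP[_ he]] id Hi.
  by rewrite ho.
by apply/negbTE; apply: he.
Qed.

Lemma init_full i v : v \in V1_init H :|: V2_init H -> i <= deg v ->
  odd i = (v \in V1_init H) -> H v i.
Proof.
move=> vP id pi; have [j jd Hj] : exists2 j, j <= deg v & H v j.
  by move: vP; rewrite !inE => /orP[]/asboolP[].
apply: (dense_uniform (leqnn (deg v)) (m := 0) (i := j) _ _ Hj _ pi) => //.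
by move=> k /andP[_ kd]; exact: init_parity.
Qed.

Lemma init_parity_sound : parity_sound (V1_init H) (V2_init H).
Proof.
move=> O oO gO v vP; apply: init_parity => //; first exact: outdeg_le_deg.
exact/goodP/gO.
Qed.

(** Any vertex of [C] can serve as [y], because [init_full] holds at every initial vertex. *)
Lemma init_component_solvable : component_solvable (V1_init H) (V2_init H).
Proof.
move=> O x C oO xP CS CP parC; have [y yC] := component_neq0 CS.
apply: (solve_component oO CS yC _ parC) => O' oO' gO'.
have inP := subsetP CP.
split=> [v vC vy|py].
  apply: init_parity; [exact: inP|exact: outdeg_le_deg|].
  by apply/goodP/gO' => //; apply: contraNneq (not_mem_component CS) => <-.
by apply/goodP; apply: init_full => //; [exact: inP|exact: outdeg_le_deg].
Qed.

(** The case of an empty trace: concentrate all badness at one vertex [y]; the total number of edges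
    then fixes the parity at [y]. *)
Lemma orient_init : V1_init H :|: V2_init H = setT ->
  odd #|V1_init H| = odd (num_edges G) -> exists O, H_orientation H O.
Proof.
move=> PT pV; have [O0 oO0] := exists_orientation.
have /card_gt0P[y _] := proj1 cG.
have [|O [oO _ gO]] := concentrate_bad oO0 (S := setT) (y := y).
  by move=> x _; apply: connected_setT; rewrite // inE.
exists O; split=> // v.
have [->|vy] := eqVneq v y; last by apply/goodP/gO; rewrite ?inE.
apply: init_full; rewrite ?PT ?inE ?outdeg_le_deg //.
have : odd (\sum_v outdeg O v) = odd (\sum_v (v \in V1_init H)).
  by rewrite sum_outdegT -pV -sum1_card big_mkcond.
rewrite (bigD1 y) //= [X in _ = odd X](bigD1 y) //= !oddD !odd_sum oddb.
rewrite (eq_bigr (fun v => odd (v \in V1_init H))).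
  by move/addIb ->; rewrite !inE.
move=> w wy; rewrite oddb.
apply: init_parity; rewrite ?PT ?inE ?outdeg_le_deg //.
by apply/goodP/gO; rewrite ?inE.
Qed.

(** * From an [H]-orientation to the parities of a trace *)

(** At each step the parities known so far force the next out-degree into its window, and it lies in
    [H], so it has the assigned parity. *)
Lemma trace_steps_parity O V1 V2 xs W1 W2 : H_orientation H O ->
  trace_steps H V1 V2 xs W1 W2 -> uniq xs ->
  {in xs, forall x, x \notin V1 :|: V2} ->
  {in V1 :|: V2, forall v, odd (outdeg O v) = (v \in V1)} ->
  forall v, (v \in V1 :|: V2) || (v \in xs) -> odd (outdeg O v) = (v \in W1).
Proof.
move=> [oO HO]; elim=> {V1 V2 xs W1 W2}
  [V1 V2|V1 V2 x xs W1 W2 px _ IH|V1 V2 x xs W1 W2 px _ IH] /=.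
- by move=> _ _ par v; rewrite orbF; exact: par.
- move=> /andP[xxs uxs] dj par v vP.
  have vP' : (v \in x |: V1 :|: V2) || (v \in xs).
    by move: vP; rewrite !inE; case: (v == x); case: (v \in V1);
      case: (v \in V2).
  have pO := px _ (outdeg_in_window x oO par) (HO x).
  apply: IH => // [y yxs|y].
    have := dj y; rewrite !inE yxs orbT => /(_ isT).
    by case: eqP yxs xxs => [->->|].
  rewrite -setUA !in_setU1; case: eqP => [-> _|_] /=; first by rewrite pO.
  exact: par.
move=> /andP[xxs uxs] dj par v vP.
have vP' : (v \in V1 :|: (x |: V2)) || (v \in xs).
  by move: vP; rewrite !inE; case: (v == x); case: (v \in V1);
    case: (v \in V2).
have pO := px _ (outdeg_in_window x oO par) (HO x).
have := dj x; rewrite mem_head inE => /(_ isT)/norP[xV _].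
apply: IH => // [y yxs|y].
  have := dj y; rewrite !inE yxs orbT => /(_ isT).
  by case: eqP yxs xxs => [->->|].
rewrite setUCA in_setU1; case: eqP => [-> _|_] /=; last exact: par.
by rewrite (negbTE pO) (negbTE xV).
Qed.

End Orientations.

Theorem theorem1p2 (G : graph) (H : vertex G -> nat -> Prop) :
  connected G -> dense H ->
  (exists O : edge G -> vertex G * vertex G, H_orientation H O) <->
  ~ (exists (xs : seq (vertex G)) (V1 V2 : {set vertex G}),
       parity_trace H xs V1 V2 /\ #|V1| <> num_edges G %[mod 2]).
Proof.
move=> _ dH; split=> [[O HO] [xs [W1 [W2 [[uxs xsE tr] []]]]]|notrace].
  have par v : odd (outdeg O v) = (v \in W1).
    apply: (trace_steps_parity HO tr uxs).
    - by move=> x; rewrite xsE inE.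
    - apply: init_parity_sound (proj1 HO) _ => // w _; exact/goodP/(proj2 HO).
    - by rewrite xsE in_setC orbN.
  rewrite !modn2 -(sum_outdegT O).
  have -> : \sum_v outdeg O v = \sum_(v in [set: vertex G]) outdeg O v.
    by apply: eq_bigl => v; rewrite inE.
  by rewrite (odd_sum_mem (B := W1)) ?setTI.
apply: contrapT => noO; apply: notrace.
have {}noO O : ~ H_orientation H O by move=> HO; apply: noO; exists O.
(* If the initial sets cover all vertices, the empty sequence is the trace. *)
have [R0|Rgt0] := posnP #|~: (V1_init H :|: V2_init H)|.
  have PT : V1_init H :|: V2_init H = setT.
    by apply/eqP; rewrite -subTset -setCS setCT subset0 -cards_eq0 R0.
  exists [::], (V1_init H), (V2_init H); split.
    by split=> //; [move=> v; rewrite PT !inE|exact: trace_nil].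
  rewrite !modn2 => /eqP pV; have [|O] := orient_init dH PT; last exact: noO.
  by move: pV; case: (odd _); case: (odd _).
have [xs [W1 [W2 [uxs xsE tr pW]]]] := exists_parity_trace dH noO
  (@init_parity_sound _ H) (init_component_solvable dH) Rgt0.
exists xs, W1, W2; split=> //.
by rewrite !modn2 => pV; move: pW pV; case: (odd _); case: (odd _).
Qed.
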